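(* Let $\Omega\subseteq\mathbb{C}$ be open and connected, let $z_0\in\Omega$, and let $u:\Omega\to\mathbb{R}$ be the real part of a holomorphic function $f:\Omega\to\mathbb{C}$ such that $k:=\min\{\ell\geq 1 : f^{(\ell)}(z_0)\neq 0\}$ (so in particular this minimum exists). Then $C_a(u,z_0)$ and $C_d(u,z_0)$ partition the unit circle into $2k$ alternating sectors of angle $\frac{\pi}{k}$. Specifically, if $se^{i\beta}$ is the polar form of $f^{(k)}(z_0)$, then $\theta$ is an argument of ascent of $u$ at $z_0$ if $$\frac{-2\beta-\pi}{2k}<\theta<\frac{-2\beta+\pi}{2k}\quad\left(\text{mod } \frac{2\pi}{k}\right),$$ i.e. if $\theta$ is congruent modulo $\frac{2\pi}{k}$ to a real number in this open interval. The interiors of the remaining sectors consist of arguments of descent of $u$ at $z_0$.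
   Context: For a harmonic function $u:\Omega\to\mathbb{R}$ and $z_0\in\Omega$, an angle $\theta\in[0,2\pi)$ is an argument of ascent of $u$ at $z_0$ if $u(z_0+te^{i\theta})>u(z_0)$ for all sufficiently small positive $t$, and an argument of descent of $u$ at $z_0$ if $u(z_0+te^{i\theta})<u(z_0)$ for all sufficiently small positive $t$. $C_a(u,z_0)$ (cone of ascent) and $C_d(u,z_0)$ (cone of descent) are the sets of arguments of ascent, respectively descent, in $[0,2\pi)$. Angles in $[0,2\pi)$ (taken modulo $2\pi$) are identified with points $e^{i\theta}$ of the unit circle. *)

(* Defs.v *)
(* MathComp-Analysis: the reals are an abstract [R : realType] and the complex
   numbers are [R[i]]. *)
From HB Require Import structures.
From mathcomp Require Import all_boot all_order all_algebra.
From mathcomp Require Import complex.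
From mathcomp Require Import all_classical all_reals all_analysis.

Set Implicit Arguments.
Unset Strict Implicit.
Unset Printing Implicit Defensive.

Import Order.TTheory GRing.Theory Num.Theory.
Import numFieldNormedType.Exports.

Local Open Scope classical_set_scope.
Local Open Scope complex_scope.
Local Open Scope ring_scope.

(* [R[i]] packaged as an abstract numeric field: only under this form does it
   inherit the library's metric topology and its structure of normed module
   over itself, so that [derivable] and [derive1n], at this type, are complex
   differentiability and iterated complex derivatives. *)
Definition Cplx (R : realType) : numClosedFieldType := R[i].

Definition cis (R : realType) (theta : R) : Cplx R := cos theta +i* sin theta.

(* Functions are total on the complex plane; only their values on [Omega], which
   is open in all uses, are relevant. *)
Definition holomorphic (R : realType) (Omega : set (Cplx R))
    (f : Cplx R -> Cplx R) : Prop :=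
  forall z, Omega z -> derivable f z 1.

Definition circle (R : realType) : set R := [set theta | 0 <= theta < 2 * pi].

Definition ascent_cone (R : realType) (u : Cplx R -> R) (z0 : Cplx R) : set R :=
  [set theta | circle theta /\
    \forall t \near 0^'+, u z0 < u (z0 + t%:C * cis theta)].

Definition descent_cone (R : realType) (u : Cplx R -> R) (z0 : Cplx R) : set R :=
  [set theta | circle theta /\
    \forall t \near 0^'+, u (z0 + t%:C * cis theta) < u z0].

Definition congr_mod (R : realType) (p x y : R) : Prop :=
  exists m : int, x = y + m%:~R * p.

(* The open arc of the circle swept by the real interval ]a, b[. *)
Definition sector (R : realType) (a b : R) : set R :=
  [set theta | circle theta /\
    exists phi, a < phi < b /\ congr_mod (2 * pi) theta phi].

(* [A] and [D] partition the circle into [2 * k] alternating sectors of angle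
   [pi / k], the first of which starts at angle [a] and belongs to [A]. The
   sectors are taken open: the [2 * k] rays that bound them may lie in [A], in
   [D] or in neither (for u = Re (z ^+ k) at 0, u is constant on them). *)
Definition alternating_sectors (R : realType) (A D : set R) (k : nat) (a : R) :
    Prop :=
  let ray (j : nat) := a + j%:R * (pi / k%:R) in
  let S (j : nat) := sector (ray j) (ray j.+1) in
  [/\ A `&` D = set0,
      trivIset `I_(2 * k) S,
      forall j, (j < 2 * k)%N -> S j `<=` (if odd j then D else A)
    & forall theta, circle theta ->
        [\/ A theta, D theta
          | exists2 j, (j < 2 * k)%N & congr_mod (2 * pi) theta (ray j)]].

(* Main.v *)
Require Import Defs.
From HB Require Import structures.
From mathcomp Require Import all_boot all_order all_algebra.
From mathcomp Require Import complex.
From mathcomp Require Import all_classical all_reals all_analysis.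
From mathcomp Require Import ring lra zify.

Set Implicit Arguments.
Unset Strict Implicit.
Unset Printing Implicit Defensive.

Import Order.TTheory GRing.Theory Num.Theory.
Import numFieldNormedType.Exports.

Local Open Scope classical_set_scope.
Local Open Scope complex_scope.
Local Open Scope ring_scope.

(** The sign of [u - u z0] on a ray from [z0] is read off the expansion
[f (z0 + z) = f z0 + c / k`! * z ^+ k + o(z ^+ k)] with [c = derive1n k f z0]:
if [c = s e^(i beta)], the real part of the main term at [z = t e^(i theta)] is
[s / k`! * t ^+ k * cos (k theta + beta)].  So [theta] is an argument of ascent
where this cosine is positive and of descent where it is negative, and the zeros
of the cosine cut the circle into [2 * k] arcs of length [pi / k].

The expansion is obtained without Cauchy's integral formula.  The operator
[derive1] takes the value 0 where there is no derivative, so a nonzero value of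
[derive1 g] at a point proves that [g] is differentiable there
([derive1_neq0_derivable]).  The other ingredient is integration
([expansion_integrate]): if [g] is differentiable near [z0] except perhaps at
[z0], and [g'] has an expansion [d z ^+ n + o(z ^+ n)], then [g] has an expansion
[b + d / (n + 1) * z ^+ n.+1 + o(z ^+ n.+1)] for some constant [b], which need
not be [g z0].  This rests on the mean value theorem for [Re g] along segments
that avoid [z0] and on the completeness of the real numbers.

If [derive1n n.+1 g z0 != 0] then [g] has a nonzero leading term at [z0]
([leading_of_derive1n_neq0]): by induction [g'] has one, hence does not vanish
at the points close to [z0] and distinct from it, hence [g] is differentiable at
these points, and its expansion comes by integration.  If moreover [g] is
differentiable at [z0] and its derivatives of orders 1 to [n] vanish there,
[first_derivative_expansion] identifies the constants: differentiability at [z0]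
forces the constant term to be [g z0], and [g' z0 = 0] forces the leading
exponent of [g'] to be positive, so that [g'] is itself differentiable at
[z0] and the induction proceeds. *)

(** * Local expansions at a point *)

(** The point [z = 0] is left out and [b] is a parameter because the expansions
found by integration say nothing about the value of [g] at [z0]. *)
Definition expansion (K : numFieldType) (g : K -> K) (z0 b d : K) (n : nat) :=
  forall e : K, 0 < e -> \forall z \near 0^',
    `|g (z + z0) - (b + d * z ^+ n)| <= e * `|z| ^+ n.

Lemma near_punctured_small (K : numFieldType) (e : K) : 0 < e ->
  \forall z \near (0 : K)^', z != 0 /\ `|z| < e.
Proof.
move=> e0; near=> z; split; first by near: z; exact: nbhs_dnbhs_neq.
near: z; apply: nbhs_dnbhs.
by apply/nbhs_ballP; exists e => //= z; rewrite /ball /= sub0r normrN.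
Unshelve. all: by end_near. Qed.

Lemma expansionW (K : numFieldType) (g : K -> K) (z0 b d : K) (m n : nat) :
  (m < n)%N -> expansion g z0 b d n -> expansion g z0 b 0 m.
Proof.
move=> mn gE e e0; 
(* For n > m the deviation from b is at most (`|d| + 1) `|z| ^+ n, which is
   below e `|z| ^+ m as soon as `|z| < 1 and `|z| < e / (`|d| + 1). *)
have d10 : 0 < `|d| + 1 by rewrite ltr_wpDl.
near=> z.
have [z_neq0 z1] : z != 0 /\ `|z| < 1 by near: z; exact: near_punctured_small.
have [_ ze] : z != 0 /\ `|z| < e / (`|d| + 1).
  by near: z; apply: near_punctured_small; rewrite divr_gt0.
have gz : `|g (z + z0) - (b + d * z ^+ n)| <= 1 * `|z| ^+ n by near: z; exact: gE.
rewrite mul0r addr0.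
have -> : g (z + z0) - b = g (z + z0) - (b + d * z ^+ n) + d * z ^+ n by ring.
apply: (le_trans (ler_normD _ _)).
have -> : `|d * z ^+ n| = `|d| * `|z| ^+ n by rewrite normrM normrX.
have zn : `|z| ^+ n <= `|z| * `|z| ^+ m.
  by rewrite -exprS; apply: ler_wiXn2l => //; exact: ltW.
apply: (@le_trans _ _ ((`|d| + 1) * `|z| ^+ n)).
  by rewrite mulrDl addrC lerD2l.
apply: (@le_trans _ _ ((`|d| + 1) * (`|z| * `|z| ^+ m))).
  by rewrite ler_wpM2l // ltW.
rewrite mulrA ler_wpM2r ?exprn_ge0 //.
by rewrite mulrC -ler_pdivlMr // ltW.
Unshelve. all: by end_near. Qed.

Lemma expansion_inj (K : numFieldType) (g : K -> K) (z0 b b' : K) :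
  expansion g z0 b 0 0 -> expansion g z0 b' 0 0 -> b = b'.
Proof.
move=> gb gb'; apply: contrapT => /eqP bb'.
have e0 : 0 < `|b - b'| by rewrite normr_gt0 subr_eq0.
have e20 : 0 < `|b - b'| / 2 / 2 by rewrite !divr_gt0.
near (0 : K)^' => z.
have h1 : `|g (z + z0) - (b + 0 * z ^+ 0)| <= `|b - b'| / 2 / 2 * `|z| ^+ 0.
  by near: z; exact: gb.
have h2 : `|g (z + z0) - (b' + 0 * z ^+ 0)| <= `|b - b'| / 2 / 2 * `|z| ^+ 0.
  by near: z; exact: gb'.
move: h1 h2; rewrite !mul0r !addr0 !expr0 !mulr1 => h1 h2.
have : `|b - b'| <= `|b - b'| / 2.
  have -> : b - b' = (g (z + z0) - b') - (g (z + z0) - b) by ring.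
  apply: (le_trans (ler_normB _ _)); rewrite [leRHS]splitr.
  have -> : g (z + z0) - b' - (g (z + z0) - b) = b - b' by ring.
  exact: lerD.
by rewrite ler_pdivlMr // mulr_natr mulr2n gerDl normr_le0 subr_eq0 (negbTE bb').
Unshelve. all: by end_near. Qed.

Lemma expansion_neq0 (K : numFieldType) (g : K -> K) (z0 d : K) (n : nat) :
  d != 0 -> expansion g z0 0 d n -> \forall z \near 0^', g (z + z0) != 0.
Proof.
move=> d0 gE; have d20 : 0 < `|d| / 2 by rewrite divr_gt0 // normr_gt0.
near=> z; apply/eqP => gz0.
have [z_neq0 _] : z != 0 /\ `|z| < 1 by near: z; exact: near_punctured_small.
have : `|g (z + z0) - (0 + d * z ^+ n)| <= `|d| / 2 * `|z| ^+ n.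
  by near: z; exact: gE.
rewrite gz0 !add0r normrN normrM normrX ler_pM2r ?exprn_gt0 ?normr_gt0 //.
rewrite ler_pdivlMr // mulr_natr mulr2n gerDl normr_le0.
by move/negP: d0.
Unshelve. all: by end_near. Qed.

Lemma expansion_leading_const (K : numFieldType) (g : K -> K) (z0 b : K) :
  expansion g z0 b 0 0 -> expansion g z0 0 b 0.
Proof.
by move=> gE e /gE; apply: filterS => z; rewrite mul0r addr0 add0r !expr0 !mulr1.
Qed.

(** Integration produces an unknown constant [b]; whether or not it vanishes, a
leading term is left. *)
Lemma expansion_leading (K : numFieldType) (g : K -> K) (z0 b d : K) (n : nat) :
  d != 0 -> expansion g z0 b d n.+1 ->
  exists m c, c != 0 /\ expansion g z0 0 c m.
Proof.
move=> d0 gE; have [b0|b_neq0] := eqVneq b 0.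
  by exists n.+1, d; split => //; rewrite -b0.
exists 0%N, b; split => //; apply: expansion_leading_const.
exact: expansionW gE.
Qed.

Lemma derivable1E (K : numFieldType) (g : K -> K) (z0 : K) :
  derivable g z0 1 = cvg (h^-1 *: (g (h + z0) - g z0) @[h --> (0 : K)^']).
Proof.
rewrite /derivable.
rewrite (_ : (fun h => _) = (fun h => h^-1 *: (g (h + z0) - g z0))) //.
by apply/funext => h /=; rewrite [h *: _]mulr1.
Qed.

Lemma derivable_expansion (K : numFieldType) (g : K -> K) (z0 : K) :
  derivable g z0 1 -> expansion g z0 (g z0) (derive1 g z0) 1.
Proof.
move=> dg e e0.
have /cvgrPdist_le/(_ _ e0) :
    h^-1 *: (g (h + z0) - g z0) @[h --> (0 : K)^'] --> derive1 g z0.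
  by move: dg; rewrite derivable1E.
apply: filterS2 (near_punctured_small ltr01) => z [z0' _].
have -> : g (z + z0) - (g z0 + derive1 g z0 * z ^+ 1) =
   - ((derive1 g z0 - z^-1 *: (g (z + z0) - g z0)) * z).
  have -> : z^-1 *: (g (z + z0) - g z0) = z^-1 * (g (z + z0) - g z0) by [].
  by field.
by move=> h; rewrite normrN normrM expr1 ler_wpM2r.
Qed.

Lemma expansion_is_derive (K : numFieldType) (g : K -> K) (z0 d : K) :
  expansion g z0 (g z0) d 1 -> derivable g z0 1 /\ derive1 g z0 = d.
Proof.
move=> gE.
have gd : h^-1 *: (g (h + z0) - g z0) @[h --> (0 : K)^'] --> d.
  apply/cvgrPdist_le => e e0; near=> z.
  have [z_neq0 _] : z != 0 /\ `|z| < 1 by near: z; exact: near_punctured_small.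
  have gz : `|g (z + z0) - (g z0 + d * z ^+ 1)| <= e * `|z| ^+ 1.
    by near: z; exact: gE.
  rewrite -(@ler_pM2r _ `|z|) ?normr_gt0 // -normrM -normrN.
  have -> : - ((d - z^-1 *: (g (z + z0) - g z0)) * z) =
     g (z + z0) - (g z0 + d * z ^+ 1).
    have -> : z^-1 *: (g (z + z0) - g z0) = z^-1 * (g (z + z0) - g z0) by [].
    by field.
  by rewrite -[in leRHS](expr1 `|z|).
split; last exact/cvg_lim.
by rewrite derivable1E; apply/cvg_ex; exists d.
Unshelve. all: by end_near. Qed.

(** * Complex functions on real segments *)

Lemma norm_real_complex (R : realType) (t : R) : `|t%:C : Cplx R| = `|t|%:C.
Proof. by rewrite normc_def /= expr0n addr0 sqrtr_sqr. Qed.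

Lemma ge0_real_complex (R : realType) (e : Cplx R) : 0 <= e ->
  e = (complex.Re e)%:C.
Proof. by case: e => a b; rewrite lecE /= => /andP[/eqP -> _]. Qed.

Lemma norm_complexE (R : realType) (z : Cplx R) :
  exists2 r : R, 0 <= r & `|z| = r%:C.
Proof.
exists (complex.Re `|z|); last exact/ge0_real_complex/normr_ge0.
by rewrite -ler0c -ge0_real_complex.
Qed.

Lemma near_real_line (R : realType) (v : Cplx R) (P : Cplx R -> Prop) :
  (\forall z \near (0 : Cplx R), P z) -> \forall t \near (0 : R), P (t%:C * v).
Proof.
move=> /nbhs_ballP[d /= d0 dP].
have [nv nv0 vE] := norm_complexE v.
have dE := ge0_real_complex (ltW d0).
have d'0 : 0 < complex.Re d by move: d0; rewrite [X in _ < X]dE ltcR.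
have nv1 : 0 < nv + 1 by rewrite ltr_wpDl.
apply/nbhs_ballP; exists (complex.Re d / (nv + 1)) => /=; first by rewrite divr_gt0.
move=> t; rewrite /ball /= sub0r normrN ltr_pdivlMr // => td.
apply: dP; rewrite /ball /= sub0r normrN normrM norm_real_complex vE dE.
rewrite -rmorphM ltcR (le_lt_trans _ td) // ler_wpM2l //.
by rewrite lerDl.
Qed.

(** Chain rule along a real line. It is proved on expansions of order 1 since
source and target are normed over different fields. *)
Lemma is_derive_Re_line (R : realType) (f : Cplx R -> Cplx R) (z v : Cplx R)
    (s : R) : derivable f (z + s%:C * v) 1 ->
  is_derive s 1 (fun t => complex.Re (f (z + t%:C * v)))
    (complex.Re (v * derive1 f (z + s%:C * v))).
Proof.
set a := z + _ * v; set L := derive1 f a => /derivable_expansion fE.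
set phi := (fun t => _).
suff /expansion_is_derive[phi_d <-] : expansion phi s (phi s) (complex.Re (v * L)) 1.
  by rewrite derive1E; exact: derivableP.
move=> e e0; have [nv nv0 vE] := norm_complexE v.
have nv1 : 0 < nv + 1 by rewrite ltr_wpDl.
have e'0 : 0 < (e / (nv + 1))%:C :> Cplx R by rewrite ltcR divr_gt0.
(* The bound extends to x = 0, where both sides vanish. *)
have {}fE : \forall x \near (0 : Cplx R),
    `|f (x + a) - (f a + L * x)| <= (e / (nv + 1))%:C * `|x|.
  have := fE _ e'0; rewrite /dnbhs near_withinE; apply: filterS => x xE.
  have [->|/xE] := eqVneq x 0; last by rewrite !expr1.
  by rewrite add0r mulr0 addr0 subrr !normr0 mulr0.
apply: nbhs_dnbhs; apply: filterS (near_real_line v fE) => t.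
rewrite !expr1 => tE; rewrite -lecR.
have -> : phi (t + s) - (phi s + complex.Re (v * L) * t) =
    complex.Re (f (t%:C * v + a) - (f a + L * (t%:C * v))).
  have -> : L * (t%:C * v) = (v * L) * t%:C by ring.
  have -> : t%:C * v + a = z + (t + s)%:C * v by rewrite rmorphD /a; ring.
  rewrite /phi -/a; case: (v * L) => p q; case: (f a) => p1 q1.
  by case: (f _) => p2 q2 /=; ring.
apply: (le_trans (normc_ge_Re _)); apply: (le_trans tE).
rewrite normrM norm_real_complex vE -!rmorphM lecR.
rewrite mulrCA mulrC ler_wpM2r // -mulrA ler_piMr ?(ltW e0) //.
by rewrite mulrC ler_pdivrMr // mul1r lerDl.
Qed.

(** The mean value theorem fails for complex values, so it is applied to the
real part alone; the imaginary part is the real part of [- 'i f]. *)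
Lemma Re_mean_value (R : realType) (f : Cplx R -> Cplx R) (z w : Cplx R) (M : R) :
  (forall s : R, 0 <= s <= 1 -> derivable f (z + s%:C * (w - z)) 1 /\
     `|derive1 f (z + s%:C * (w - z))| <= M%:C) ->
  `|complex.Re (f w) - complex.Re (f z)|%:C <= M%:C * `|w - z|.
Proof.
move=> fM; set v := w - z.
have phi_d (s : R) : 0 <= s <= 1 ->
    is_derive s 1 (fun t => complex.Re (f (z + t%:C * v)))
      (complex.Re (v * derive1 f (z + s%:C * v))).
  by move=> /fM[fd _]; exact: is_derive_Re_line.
have [||c] := @MVT R (fun t => complex.Re (f (z + t%:C * v)))
    (fun s => complex.Re (v * derive1 f (z + s%:C * v))) 0 1 ltr01.
- by move=> x; rewrite in_itv /= => /andP[x0 x1]; apply: phi_d; rewrite !ltW.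
- apply: derivable_within_continuous => x; rewrite in_itv /= => x01.
  by have [] := phi_d x x01.
rewrite in_itv /= => /andP[c0 c1]; rewrite subr0 mulr1 mul1r mul0r addr0.
rewrite {1}/v [z + _]addrC subrK => ->.
apply: (le_trans (normc_ge_Re _)); rewrite normrM mulrC ler_wpM2r //.
by have [|_] := fM c; first by rewrite !ltW.
Qed.

(** * Oscillation on a punctured disc *)

Lemma Re_oscillation_segment (R : realType) (h : Cplx R -> Cplx R)
    (z0 x y : Cplx R) (r M : R) :
  (forall z, z != 0 -> `|z| <= r%:C ->
     derivable h (z + z0) 1 /\ `|derive1 h (z + z0)| <= M%:C) ->
  `|x| <= r%:C -> `|y| <= r%:C ->
  (forall s : R, 0 <= s <= 1 -> x + s%:C * (y - x) != 0) ->
  `|complex.Re (h (y + z0)) - complex.Re (h (x + z0))| <= 2 * M * r.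
Proof.
move=> hM xr yr xy0; rewrite -lecR.
have hM' (s : R) : 0 <= s <= 1 ->
    derivable h (x + z0 + s%:C * (y + z0 - (x + z0))) 1 /\
    `|derive1 h (x + z0 + s%:C * (y + z0 - (x + z0)))| <= M%:C.
  move=> s01.
  have -> : x + z0 + s%:C * (y + z0 - (x + z0)) = x + s%:C * (y - x) + z0 by ring.
  apply: hM; first exact: xy0.
  have -> : x + s%:C * (y - x) = (1 - s)%:C * x + s%:C * y.
    by rewrite rmorphB rmorph1; ring.
  apply: (le_trans (ler_normD _ _)); rewrite !normrM !norm_real_complex.
  case/andP: s01 => s0 s1; have s1' : 0 <= 1 - s by rewrite subr_ge0.
  rewrite (ger0_norm s0) (ger0_norm s1').
  have -> : r%:C = (1 - s)%:C * r%:C + s%:C * r%:C :> Cplx R.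
    by rewrite rmorphB rmorph1; ring.
  have s'0 : 0 <= (1 - s)%:C :> Cplx R by rewrite ler0c.
  have s''0 : 0 <= s%:C :> Cplx R by rewrite ler0c.
  apply: lerD; apply: ler_wpM2l => //.
apply: (le_trans (Re_mean_value hM')).
have M0 : 0 <= M%:C :> Cplx R.
  have [_] := hM' 0 ltac:(by rewrite lexx ler01).
  by apply: le_trans.
have -> : (2 * M * r)%:C = M%:C * (r%:C + r%:C) :> Cplx R.
  by rewrite !rmorphM rmorph_nat; ring.
rewrite ler_wpM2l //; have -> : y + z0 - (x + z0) = y - x by ring.
by apply: (le_trans (ler_normB _ _)); rewrite lerD.
Qed.

(** A punctured disc is not convex: when the segment from [x] to [y] meets the
centre, [y] is a negative multiple of [x], and the path through ['i * x] avoids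
the centre. Either path has length at most [4 * r]. *)
Lemma Re_oscillation (R : realType) (h : Cplx R -> Cplx R)
    (z0 x y : Cplx R) (r M : R) :
  (forall z, z != 0 -> `|z| <= r%:C ->
     derivable h (z + z0) 1 /\ `|derive1 h (z + z0)| <= M%:C) ->
  x != 0 -> y != 0 -> `|x| <= r%:C -> `|y| <= r%:C ->
  `|complex.Re (h (y + z0)) - complex.Re (h (x + z0))| <= 4 * M * r.
Proof.
move=> hM x0 y0 xr yr.
have [xy|] := pselect (forall s : R, 0 <= s <= 1 -> x + s%:C * (y - x) != 0).
  have h1 := Re_oscillation_segment hM xr yr xy.
  apply: (le_trans h1); have := le_trans (normr_ge0 _) h1; lra.
move=> /existsNP[s /not_implyP[/andP[s0 s1] /negP]]; rewrite negbK => /eqP xys.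
have ix_r : `|'i%C * x| <= r%:C :> Cplx R.
  by rewrite normrM normc_def /= expr0n expr1n add0r sqrtr1 mul1r.
have lt0s : 0 < s.
  rewrite lt_neqAle s0 andbT; apply/eqP => s0'; move: xys x0.
  by rewrite -s0' mul0r addr0 => ->; rewrite eqxx.
(* s is the parameter at which the segment from x to y meets the centre. *)
have yE : y = (- ((1 - s) / s))%:C * x.
  have s_neq0 : s%:C != 0 :> Cplx R by rewrite eq_complex /= eqxx andbT gt_eqF.
  apply: (mulfI s_neq0); rewrite mulrA -rmorphM.
  have -> : s * - ((1 - s) / s) = s - 1 by field; rewrite gt_eqF.
  rewrite rmorphB rmorph1; apply/eqP; rewrite -subr_eq0 -xys; apply/eqP; ring.
set l := (1 - s) / s in yE.
have l_neq0 : l != 0.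
  by apply/eqP => l0; move: y0; rewrite yE l0 oppr0 mul0r eqxx.
have seg1 (t : R) : 0 <= t <= 1 -> x + t%:C * ('i%C * x - x) != 0.
  move=> _; have -> : x + t%:C * ('i%C * x - x) = (1 + t%:C * ('i%C - 1)) * x by ring.
  rewrite mulf_neq0 // eq_complex /=; apply/negP => /andP[/eqP h1 /eqP h2].
  by clear -h1 h2; lra.
have seg2 (t : R) : 0 <= t <= 1 ->
    'i%C * x + t%:C * (y - 'i%C * x) != 0.
  move=> _; have -> : 'i%C * x + t%:C * (y - 'i%C * x) =
     ('i%C + t%:C * ((- l)%:C - 'i%C)) * x by rewrite yE; ring.
  rewrite mulf_neq0 // eq_complex /=; apply/negP => /andP[/eqP h1 /eqP h2].
  have t1 : t = 1 by clear -h2; lra.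
  by move/eqP: l_neq0; apply; clear -h1 t1; rewrite t1 in h1; lra.
have b1 := Re_oscillation_segment hM xr ix_r seg1.
have b2 := Re_oscillation_segment hM ix_r yr seg2.
set p := complex.Re (h (y + z0)) in b2 *.
set q := complex.Re (h (x + z0)) in b1 *.
set m := complex.Re (h ('i%C * x + z0)) in b1 b2.
have -> : p - q = (p - m) + (m - q) by ring.
by apply: (le_trans (ler_normD _ _)); apply: (le_trans (lerD b2 b1)); clear; lra.
Qed.

(** * Integration of expansions *)

Lemma near_punctured_disc (R : realType) (P : Cplx R -> Prop) :
  (\forall z \near 0^', P z) ->
  exists2 d : R, 0 < d & forall z, z != 0 -> `|z| < d%:C -> P z.
Proof.
rewrite /dnbhs near_withinE => /nbhs_ballP[d /= d0 dP].
have dE := ge0_real_complex (ltW d0).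
exists (complex.Re d); first by move: d0; rewrite [X in _ < X]dE ltcR.
by move=> z z0 zd; apply: dP => //; rewrite /ball /= sub0r normrN dE.
Qed.

Lemma Re_oscillation_small (R : realType) (h : Cplx R -> Cplx R) (z0 : Cplx R)
    (n : nat) :
  (\forall z \near 0^', derivable h (z + z0) 1) ->
  expansion (derive1 h) z0 0 0 n ->
  forall e : R, 0 < e -> exists2 d : R, 0 < d &
    forall (r : R) (x y : Cplx R), 0 < r < d -> x != 0 -> y != 0 ->
      `|x| <= r%:C -> `|y| <= r%:C ->
      `|complex.Re (h (y + z0)) - complex.Re (h (x + z0))| <= e * r ^+ n.+1.
Proof.
move=> hd h'E e e0.
have e4 : 0 < (e / 4)%:C :> Cplx R by rewrite ltcR divr_gt0.
have [d d0 dP] := near_punctured_disc (filterI hd (h'E _ e4)).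
exists d => // r x y /andP[r0 rd] x0 y0 xr yr.
have -> : e * r ^+ n.+1 = 4 * (e / 4 * r ^+ n) * r by rewrite exprS; field.
apply: (Re_oscillation _ x0 y0 xr yr) => z z_neq0 zr.
have [|hz h'z] := dP z z_neq0; first by rewrite (le_lt_trans zr) // ltcR.
split=> //; move: h'z; rewrite mul0r addr0 subr0 => /le_trans; apply.
have [nz nz0 nzE] := norm_complexE z; move: zr; rewrite nzE lecR => zr.
rewrite -rmorphXn -rmorphM lecR ler_wpM2l ?divr_ge0 // ?(ltW e0) //.
by apply: lerXn2r => //; rewrite nnegrE // ltW.
Qed.

(** The oscillation of [Re h] on the disc of radius [r] is [o(r ^+ n.+1)]; hence
[Re h] is Cauchy at [z0], and letting one of the two points tend to [z0] bounds
the distance of [Re h] to its limit. *)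
Lemma Re_punctured_limit (R : realType) (h : Cplx R -> Cplx R) (z0 : Cplx R)
    (n : nat) :
  (\forall z \near 0^', derivable h (z + z0) 1) ->
  expansion (derive1 h) z0 0 0 n ->
  exists b : R, forall e : R, 0 < e -> \forall z \near 0^',
    `|complex.Re (h (z + z0)) - b|%:C <= e%:C * `|z| ^+ n.+1.
Proof.
move=> hd h'E; have osc := Re_oscillation_small hd h'E.
pose phi z := complex.Re (h (z + z0)).
have : cvg (phi z @[z --> (0 : Cplx R)^']).
  apply/cauchy_cvgP/cauchy_exP => e e0.
  have [d d0 dP] := osc 1 ltr01.
  (* On the disc of radius r the oscillation is at most r ^+ n.+1 <= r < e. *)
  pose r := Num.min (d / 2) (Num.min 1 (e / 2)).
  have r0 : 0 < r by rewrite !lt_min !divr_gt0 // ltr01.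
  have rd : r < d by rewrite !gt_min ltr_pdivrMr // ltr_pMr // ltr1n.
  have r1 : r <= 1 by rewrite !ge_min lexx !orbT.
  have re : r <= e / 2 by rewrite !ge_min lexx !orbT.
  have rC0 : 0 < r%:C :> Cplx R by rewrite ltcR.
  exists (phi r%:C).
  change (\forall z \near (0 : Cplx R)^', ball (phi r%:C) e (phi z)).
  near=> z; rewrite /ball /= distrC.
  have [z_neq0 zr] : z != 0 /\ `|z| < r%:C by near: z; exact: near_punctured_small.
  have := dP r r%:C z; rewrite r0 rd (gt_eqF rC0) z_neq0 norm_real_complex.
  rewrite (gtr0_norm r0) lexx (ltW zr) => /(_ isT isT isT isT isT).
  move=> /le_lt_trans; apply; rewrite mul1r exprS.
  apply: (@le_lt_trans _ _ r); last first.
    by rewrite (le_lt_trans re) // ltr_pdivrMr // ltr_pMr // ltr1n.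
  by rewrite ler_piMr ?(ltW r0) // exprn_ile1 // ltW.
move=> /cvg_ex[b phib]; exists b => e e0; have [d d0 dP] := osc e e0.
have dC0 : 0 < d%:C :> Cplx R by rewrite ltcR.
near=> z.
have [z_neq0 zd] : z != 0 /\ `|z| < d%:C by near: z; exact: near_punctured_small.
have [r r0 rE] := norm_complexE z; rewrite rE -rmorphXn -rmorphM lecR.
have {}r0 : 0 < r by rewrite -ltcR -rE normr_gt0.
have rC0 : 0 < r%:C :> Cplx R by rewrite ltcR.
apply/ler_addgt0Pl => t t0.
near (0 : Cplx R)^' => y.
have [y_neq0 yr] : y != 0 /\ `|y| < r%:C by near: y; exact: near_punctured_small.
have yb : `|b - phi y| <= t by near: y; move/cvgrPdist_le: phib; apply.
have -> : complex.Re (h (z + z0)) - b = - (b - phi y) + (phi z - phi y).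
  by rewrite /phi; ring.
apply: (le_trans (ler_normD _ _)); rewrite normrN lerD //.
apply: dP => //; [|exact: ltW|by rewrite rE].
by rewrite r0 -ltcR -rE.
Unshelve. all: by end_near. Qed.

Lemma expansion_const_of_small_derive (R : realType) (h : Cplx R -> Cplx R)
    (z0 : Cplx R) (n : nat) :
  (\forall z \near 0^', derivable h (z + z0) 1) ->
  expansion (derive1 h) z0 0 0 n -> exists b, expansion h z0 b 0 n.+1.
Proof.
move=> hd h'E.
have ih'E z : derivable h z 1 ->
    derivable ((- 'i%C : Cplx R) *: h) z 1 /\
    derive1 ((- 'i%C : Cplx R) *: h) z = (- 'i%C) * derive1 h z.
  by move=> hz; split; [exact: derivableZ|rewrite !derive1E deriveZ].
have [b1 b1P] := Re_punctured_limit hd h'E.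
have [||b2 b2P] := @Re_punctured_limit R ((- 'i%C : Cplx R) *: h) z0 n.
- by apply: filterS hd => z /ih'E[].
- move=> e e0; apply: filterS2 hd (h'E e e0) => z /ih'E[_ ->].
  rewrite mul0r !addr0 !subr0 normrM normrN.
  by rewrite [`|'i%C|]normc_def /= expr0n expr1n add0r sqrtr1 mul1r.
exists (b1 +i* b2) => e e0.
have eE := ge0_real_complex (ltW e0).
have e20 : 0 < complex.Re e / 2 by rewrite divr_gt0 // -ltcR -eE.
apply: filterS2 (b1P _ e20) (b2P _ e20) => z z1 z2.
rewrite mul0r addr0.
have -> : e = (complex.Re e / 2)%:C + (complex.Re e / 2)%:C.
  by rewrite -rmorphD -splitr.
rewrite mulrDl; apply: le_trans (lerD z1 z2).
have -> : complex.Re (((- 'i%C : Cplx R) *: h) (z + z0)) = complex.Im (h (z + z0)).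
  have -> : ((- 'i%C : Cplx R) *: h) (z + z0) = - 'i%C * h (z + z0) by [].
  by case: (h _) => p q /=; ring.
case: (h _) => p q /=; rewrite [X in `|X|](_ : _ = (p - b1)%:C + 'i%C * (q - b2)%:C).
  apply: (le_trans (ler_normD _ _)); rewrite normrM !norm_real_complex.
  by rewrite normc_def /= expr0n expr1n add0r sqrtr1 mul1r.
by apply/eqP; rewrite eq_complex /=; apply/andP; split; apply/eqP; ring.
Qed.

Lemma is_derive_monomial (K : numFieldType) (c z0 z : K) (n : nat) :
  is_derive z 1 (fun w => c * (w - z0) ^+ n.+1) (c * (n.+1%:R * (z - z0) ^+ n)).
Proof.
have lin : is_derive z 1 (id - cst z0 : K -> K) 1.
  by rewrite -[X in is_derive _ _ _ X](subr0 1); exact: is_deriveB.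
have -> : (fun w => c * (w - z0) ^+ n.+1) = c *: (id - cst z0 : K -> K) ^+ n.+1.
  by apply/funext => w; rewrite [in RHS]exprfctE.
apply: is_derive_eq.
by rewrite [_ *: 1]mulr1 [c *: _]/(c * _) /= -mulr_natl.
Qed.

(** Subtracting the primitive of [d * (z - z0) ^+ n] reduces to [d = 0]. *)
Lemma expansion_integrate (R : realType) (g : Cplx R -> Cplx R)
    (z0 d : Cplx R) (n : nat) :
  (\forall z \near 0^', derivable g (z + z0) 1) ->
  expansion (derive1 g) z0 0 d n ->
  exists b, expansion g z0 b (d / n.+1%:R) n.+1.
Proof.
move=> gd g'E; set c := d / n.+1%:R.
pose Q w : Cplx R := c * (w - z0) ^+ n.+1.
have Qd z := is_derive_monomial c z0 z n.
have h'E z : derivable g z 1 -> derivable (g - Q) z 1 /\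
    derive1 (g - Q) z = derive1 g z - d * (z - z0) ^+ n.
  move=> gz; have [Qz Q'z] := Qd z.
  split; first exact: derivableB.
  rewrite derive1E (deriveB gz Qz) -derive1E; congr (_ - _).
  by apply: (etrans Q'z); rewrite mulrA divfK // pnatr_eq0.
have [||b bE] := @expansion_const_of_small_derive R (g - Q) z0 n.
- by apply: filterS gd => z /h'E[].
- move=> e e0; apply: filterS2 gd (g'E e e0) => z /h'E[_ ->].
  by rewrite addrK mul0r !add0r subr0.
exists b => e e0; apply: filterS (bE e e0) => z.
have -> : (g - Q) (z + z0) = g (z + z0) - c * z ^+ n.+1.
  by transitivity (g (z + z0) - Q (z + z0)); rewrite // /Q addrK.
by congr (`|_| <= _); ring.
Qed.

(** * The expansion given by the first nonzero derivative *)

(** A limit that does not exist is given the default value, which is 0 here. *)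
Lemma derive1_neq0_derivable (R : realType) (g : Cplx R -> Cplx R) (z : Cplx R) :
  derive1 g z != 0 -> derivable g z 1.
Proof.
move=> /eqP g'z; rewrite derivable1E; apply: contrapT => /dvgP g0.
by apply: g'z; rewrite /derive1 g0.
Qed.

Lemma near_derivable_of_leading (R : realType) (g : Cplx R -> Cplx R)
    (z0 d : Cplx R) (n : nat) : d != 0 -> expansion (derive1 g) z0 0 d n ->
  \forall z \near 0^', derivable g (z + z0) 1.
Proof.
move=> d0 /(expansion_neq0 d0); apply: filterS => z.
exact: derive1_neq0_derivable.
Qed.

(** By induction [g'] has a nonzero leading term, so [g'] does not vanish at
the points close to [z0] and distinct from it; this makes [g] differentiable at
these points, and [g'] can be integrated. *)
Lemma leading_of_derive1n_neq0 (R : realType) (n : nat) (g : Cplx R -> Cplx R)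
    (z0 : Cplx R) : derive1n n.+1 g z0 != 0 ->
  exists m c, c != 0 /\ expansion g z0 0 c m.
Proof.
elim: n g => [|n IH] g g0.
  by apply: (expansion_leading g0); exact/derivable_expansion/derive1_neq0_derivable.
rewrite derive1Sn in g0; have [m [c [c0 g'E]]] := IH _ g0.
have [b gE] := expansion_integrate (near_derivable_of_leading c0 g'E) g'E.
by apply: (expansion_leading _ gE); rewrite mulf_neq0 // invr_eq0 pnatr_eq0.
Qed.

(** Differentiability is assumed at [z0] only, which is what the induction can
pass on from [g] to [g']. *)
Lemma first_derivative_expansion (R : realType) (n : nat) (g : Cplx R -> Cplx R)
    (z0 : Cplx R) : derivable g z0 1 -> derive1n n.+1 g z0 != 0 ->
  (forall l, (1 <= l <= n)%N -> derive1n l g z0 = 0) ->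
  expansion g z0 (g z0) (derive1n n.+1 g z0 / n.+1`!%:R) n.+1.
Proof.
elim: n g => [|n IH] g gd gn0 gl0.
  by rewrite (_ : 1`! = 1)%N ?divr1 //; exact: derivable_expansion.
rewrite derive1Sn in gn0 *.
have g'0 : derive1 g z0 = 0 by exact: (gl0 1%N).
have [m [c [c0 g'E]]] := leading_of_derive1n_neq0 gn0.
have gnear := near_derivable_of_leading c0 g'E.
have const b d k : expansion g z0 b d k.+1 -> b = g z0.
  move=> gE; apply: (@expansion_inj _ g z0); first exact: expansionW gE.
  exact: expansionW (derivable_expansion gd).
(* If the leading exponent m of g' were 0, then g would have derivative c != 0
   at z0, against g' z0 = 0. For m > 0 the expansion of g', whose constant term is g' z0 = 0, gives
   a derivative of g' at z0. *)
have [e g'e] : exists e, expansion (derive1 g) z0 (derive1 g z0) e 1.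
  rewrite g'0; case: m g'E => [|[|m]] g'E; [|by exists c|].
    have [b gE] := expansion_integrate gnear g'E.
    have bE := const _ _ _ gE; rewrite bE divr1 in gE.
    have [_ g'c] := expansion_is_derive gE.
    by move: c0; rewrite -g'c g'0 eqxx.
  by exists 0; exact: expansionW g'E.
have [g'd _] := expansion_is_derive g'e.
have {}g'E : expansion (derive1 g) z0 0 (derive1n n.+1 (derive1 g) z0 / n.+1`!%:R) n.+1.
  rewrite -[X in expansion _ _ X]g'0; apply: IH => // l /andP[l1 ln].
  by rewrite -derive1Sn gl0.
have [b gE] := expansion_integrate gnear g'E.
move: (gE); rewrite (const _ _ _ gE).
by rewrite -mulrA -invfM -natrM [in X in expansion _ _ _ X]mulnC -factS.
Qed.

(** * Polar coordinates and rays *)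

Lemma cisD (R : realType) (a b : R) : cis (a + b) = cis a * cis b.
Proof.
by apply/eqP; rewrite eq_complex /= cosD sinD; apply/andP; split; apply/eqP; ring.
Qed.

Lemma cisX (R : realType) (a : R) (n : nat) : cis a ^+ n = cis (n%:R * a).
Proof.
elim: n => [|n IH]; first by rewrite mul0r expr0 /cis cos0 sin0.
by rewrite exprS IH -cisD; congr cis; rewrite -addn1 natrD; ring.
Qed.

Lemma norm_cis (R : realType) (a : R) : `|cis a| = 1.
Proof. by rewrite normc_def /= cos2Dsin2 sqrtr1. Qed.

Lemma polar_form (R : realType) (c : Cplx R) : c != 0 ->
  exists s beta : R, 0 < s /\ c = s%:C * cis beta.
Proof.
move=> c0; have [s s0 cE] := norm_complexE c.
have {}s0 : 0 < s by rewrite -ltcR -cE normr_gt0.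
have s_neq0 := lt0r_neq0 s0.
have : complex.Re c ^+ 2 + complex.Im c ^+ 2 = s ^+ 2.
  by apply: complexI; rewrite [LHS]add_Re2_Im2 cE -rmorphXn.
case: c {cE c0} => a b /= ab.
have ab1 : (a / s) ^+ 2 + (b / s) ^+ 2 = 1.
  by rewrite !expr_div_n -mulrDl ab divff // expf_neq0.
have a1 : -1 <= a / s <= 1.
  rewrite -ler_norml -(expr_le1 (n := 2)) // real_normK ?num_real //.
  by rewrite -ab1 lerDl sqr_ge0.
have sin_acos1 : sin (acos (a / s)) = `|b / s|.
  by rewrite sin_acos // -{1}ab1 addrC addKr sqrtr_sqr.
exists s; have [b0|b0] := leP 0 (b / s).
  exists (acos (a / s)); split=> //; apply/eqP; rewrite eq_complex /=.
  rewrite sin_acos1 acosK ?in_itv //= ger0_norm //.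
  by apply/andP; split; apply/eqP; field.
exists (- acos (a / s)); split=> //; apply/eqP; rewrite eq_complex /=.
rewrite cosN sinN sin_acos1 acosK ?in_itv //= ltr0_norm //.
by apply/andP; split; apply/eqP; field.
Qed.

Lemma Re_expansion_ray (R : realType) (f : Cplx R -> Cplx R) (z0 : Cplx R)
    (s beta theta : R) (k : nat) :
  expansion f z0 (f z0) (s%:C * cis beta) k ->
  forall e : R, 0 < e -> \forall t \near 0^'+,
    `|complex.Re (f (z0 + t%:C * cis theta)) - complex.Re (f z0) -
      s * cos (k%:R * theta + beta) * t ^+ k| <= e * t ^+ k.
Proof.
move=> fE e e0; have eC0 : 0 < e%:C :> Cplx R by rewrite ltcR.
have := fE _ eC0; rewrite /dnbhs near_withinE => /(near_real_line (cis theta)).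
move=> fray; near=> t.
have t0 : 0 < t by [].
have tC0 : 0 < t%:C :> Cplx R by rewrite ltcR.
have tE : `|t%:C * cis theta| = t%:C.
  by rewrite normrM norm_cis mulr1 norm_real_complex gtr0_norm.
have t_neq0 : t%:C * cis theta != 0 by rewrite -normr_eq0 tE gt_eqF.
have : t%:C * cis theta != 0 ->
    `|f (t%:C * cis theta + z0) -
      (f z0 + s%:C * cis beta * (t%:C * cis theta) ^+ k)| <=
    e%:C * `|t%:C * cis theta| ^+ k.
  by near: t; apply: cvg_within; exact: fray.
move=> /(_ t_neq0); rewrite tE -rmorphXn -rmorphM => ft.
rewrite -lecR; apply: le_trans ft; apply: le_trans (normc_ge_Re _).
rewrite exprMn_comm; last exact: mulrC.
rewrite cisX -rmorphXn.
have -> : s%:C * cis beta * ((t ^+ k)%:C * cis (k%:R * theta)) =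
    (s * t ^+ k)%:C * cis (k%:R * theta + beta).
  by rewrite cisD rmorphM; ring.
rewrite lecR [_ + z0]addrC; case: (f z0) => p q; case: (f _) => p' q' /=.
by rewrite le_eqVlt; apply/orP; left; apply/eqP; congr `|_|; ring.
Unshelve. all: by end_near. Qed.

(** * Sectors of the circle *)

Lemma cos_periodz (R : realType) (x : R) (m : int) :
  cos (x + m%:~R * (2 * pi)) = cos x.
Proof.
have per (y : R) (n : nat) : cos (y + n%:R * (2 * pi)) = cos y.
  by rewrite mulr_natl [2 * _]mulr_natl (periodicn (@cosD2pi R)).
case: m => n; first exact: per.
by rewrite -[LHS](per _ n.+1) NegzE mulrNz -pmulrn mulNr subrK.
Qed.

Lemma cos_sign (R : realType) (x : R) (j : nat) :
  j%:R * pi - pi / 2 < x < j%:R * pi + pi / 2 -> 0 < (-1) ^+ j * cos x.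
Proof.
move=> /andP[x1 x2]; have -> : x = x - j%:R * pi + pi *+ j.
  by rewrite -(mulr_natl pi) subrK.
rewrite (alternatingn (@cosDpi R)) mulrA -exprD addnn -mul2n exprM sqrrN expr1n.
by rewrite expr1n mul1r; apply: cos_gt0_pihalf; apply/andP; split; lra.
Qed.

(** The sectors are the arcs on which the phase [k * phi + beta] lies between
two consecutive zeros of the cosine. *)
Lemma sector_phase (R : realType) (k : nat) (beta phi : R) (j : nat) :
  (0 < k)%N ->
  let a := (- (2 * beta) - pi) / (2 * k%:R) in
  (a + j%:R * (pi / k%:R) < phi < a + j.+1%:R * (pi / k%:R)) =
  (j%:R * pi - pi / 2 < k%:R * phi + beta < j%:R * pi + pi / 2).
Proof.
move=> k0 a; have kR : 0 < k%:R :> R by rewrite ltr0n.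
have aE (i : R) : k%:R * (a + i * (pi / k%:R)) + beta = i * pi - pi / 2.
  by rewrite /a; field; rewrite gt_eqF.
rewrite -(ltr_pM2l kR _ phi) -(ltr_pM2l kR phi) -(ltrD2r beta) aE.
rewrite -(ltrD2r beta (k%:R * phi)) aE; congr (_ && (_ < _)).
by rewrite -addn1 natrD; field.
Qed.

Lemma phase_congr (R : realType) (k : nat) (beta theta phi p : R) (m : int) :
  k%:R * p = 2 * pi -> theta = phi + m%:~R * p ->
  cos (k%:R * theta + beta) = cos (k%:R * phi + beta).
Proof.
move=> kp ->; rewrite -[RHS](cos_periodz _ m) -kp; congr cos; ring.
Qed.

Lemma sector_cos_sign (R : realType) (k : nat) (beta theta : R) (j : nat) :
  (0 < k)%N ->
  let a := (- (2 * beta) - pi) / (2 * k%:R) in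
  sector (a + j%:R * (pi / k%:R)) (a + j.+1%:R * (pi / k%:R)) theta ->
  0 < (-1) ^+ j * cos (k%:R * theta + beta).
Proof.
move=> k0 a [_ [phi [phi_j [m thetaE]]]].
have -> : cos (k%:R * theta + beta) = cos (k%:R * phi + beta).
  rewrite -[RHS](cos_periodz _ (k%:Z * m)) thetaE intrM -pmulrn.
  by congr cos; ring.
by apply: cos_sign; rewrite -sector_phase.
Qed.

Lemma int_multiple_lt (R : realType) (m : int) (p : R) :
  0 < p -> `|m%:~R * p| < p -> m = 0.
Proof.
move=> p0; rewrite normrM (gtr0_norm p0) -[X in _ < X]mul1r ltr_pM2r //.
by rewrite -intr_norm -[1]/(1%:~R) ltr_int; lia.
Qed.

(** If [theta] lies in the sectors [i] and [j], with representatives that differ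
by [(n - m) * (2 * pi)], then the offsets of these representatives in their
sectors, both in the interval from 0 to [p = pi / k], differ by the multiple
[i - j - 2 * k * (n - m)] of [p]; this multiple is therefore 0, and [i = j] as
both are less than [2 * k]. *)
Lemma sectors_trivIset (R : realType) (k : nat) (a : R) : (0 < k)%N ->
  trivIset `I_(2 * k)
    (fun j => sector (a + j%:R * (pi / k%:R)) (a + j.+1%:R * (pi / k%:R))).
Proof.
move=> k0 i j /= ik jk [theta [[_ [phi [phi_i [m E]]]]]].
move=> [_ [psi [psi_j [n E']]]].
have kR : 0 < k%:R :> R by rewrite ltr0n.
set p := pi / k%:R in phi_i psi_j.
have p0 : 0 < p by rewrite divr_gt0 ?pi_gt0.
have piE : pi = k%:R * p by rewrite /p; field; rewrite gt_eqF.
pose M : int := (i%:Z - j%:Z) - 2 * k%:Z * (n - m).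
have ME : M%:~R * p = (psi - (a + j%:R * p)) - (phi - (a + i%:R * p)).
  have -> : psi = phi + m%:~R * (2 * (k%:R * p)) - n%:~R * (2 * (k%:R * p)).
    by rewrite -piE -E E' addrK.
  by rewrite /M !(intrD, intrM, intrN, mulrNz) -!pmulrn; ring.
have M0 : M = 0.
  apply: (int_multiple_lt p0); rewrite ME.
  have offset (l : nat) (y : R) : a + l%:R * p < y < a + l.+1%:R * p ->
      0 < y - (a + l%:R * p) < p.
    rewrite -addn1 natrD mulrDl mul1r addrA => /andP[y1 y2].
    by rewrite subr_gt0 y1 ltrBlDl.
  move: (offset _ _ phi_i) (offset _ _ psi_j).
  move: (psi - _) (phi - _) => y y'; clear => /andP[? ?] /andP[? ?].
  by rewrite ltr_norml; apply/andP; split; lra.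
move: M0 ik jk; rewrite /M; move: (n - m) => N; clear => M0 ik jk.
have [N0|[N0|N0]] : N <= -1 \/ N = 0 \/ 1 <= N by lia.
- by nia.
- by move: M0; rewrite N0; lia.
- by nia.
Qed.

Lemma alternating_sectors_cos (R : realType) (A D : set R) (k : nat) (beta : R) :
  (0 < k)%N -> A `&` D = set0 ->
  (forall theta, circle theta -> 0 < cos (k%:R * theta + beta) -> A theta) ->
  (forall theta, circle theta -> cos (k%:R * theta + beta) < 0 -> D theta) ->
  alternating_sectors A D k ((- (2 * beta) - pi) / (2 * k%:R)).
Proof.
move=> k0 AD0 Apos Dneg ray S.
have kR : 0 < k%:R :> R by rewrite ltr0n.
have S_AD j : S j `<=` (if odd j then D else A).
  move=> theta Sj; have := sector_cos_sign k0 Sj; case: Sj => th_circ _.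
  rewrite -signr_odd; case: (odd j); rewrite ?expr1 ?expr0 ?mulN1r ?mul1r.
    by rewrite oppr_gt0; exact: Dneg.
  exact: Apos.
split => //; first exact: sectors_trivIset.
move=> theta th_circ.
(* n is the index of the half-open sector of the real line containing theta;
   reducing it modulo 2 * k gives the index of the sector of the circle. *)
set x := (k%:R * theta + beta + pi / 2) / pi.
pose n := Num.floor x.
have pi0 := pi_gt0 R.
have xE : k%:R * theta + beta = x * pi - pi / 2.
  by rewrite /x divfK ?gt_eqF // addrK.
have /andP[nx xn] := floor_itv x; rewrite -/n in nx xn.
have k20 : (2 * k)%:Z != 0 by lia.
pose q := (n %/ (2 * k)%:Z)%Z.
have [j jE] : exists j : nat, (n %% (2 * k)%:Z)%Z = j%:Z.
  by exists `|(n %% (2 * k)%:Z)%Z|%N; rewrite gez0_abs // modz_ge0.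
have jk : (j < 2 * k)%N by have := @ltz_pmod n (2 * k)%:Z ltac:(lia); lia.
have nE : n%:~R = q%:~R * (2 * k%:R) + j%:R :> R.
  by rewrite {1}(divz_eq n (2 * k)%:Z) jE intrD intrM -/q -!pmulrn natrM.
pose phi := theta - q%:~R * (2 * pi).
have thE : congr_mod (2 * pi) theta phi by exists q; rewrite /phi subrK.
have phiE : k%:R * phi + beta = (x - q%:~R * (2 * k%:R)) * pi - pi / 2.
  by rewrite mulrBl -addrAC -xE /phi; ring.
have [xn_eq|xn_neq] := eqVneq x n%:~R.
  apply: Or33; exists j => //; exists q; rewrite -[LHS](subrK (q%:~R * (2 * pi))).
  congr (_ + _); rewrite -/phi /ray.
  have {}phiE : k%:R * phi = j%:R * pi - pi / 2 - beta.
    by rewrite -[LHS](addrK beta) phiE xn_eq nE; ring.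
  rewrite -[phi](mulKf (lt0r_neq0 kR)) phiE; field; exact: lt0r_neq0.
have {xn_neq}nx' : n%:~R < x by rewrite lt_neqAle eq_sym xn_neq.
have : S j theta.
  split=> //; exists phi; split => //.
  rewrite sector_phase // phiE; move: nx' xn; rewrite intrD nE.
  move: (_ * (2 * _)) => y yx xy; apply/andP; split.
    by rewrite ltrD2r ltr_pM2r // ltrBrDl.
  have -> : j%:R * pi + pi / 2 = (j%:R + 1 : R) * pi - pi / 2 by field.
  by rewrite ltrD2r ltr_pM2r // ltrBlDl addrA.
move=> /S_AD; case: (odd j); [exact: Or32|exact: Or31].
Qed.

(** * Ascent and descent *)

Lemma ascent_descent_disjoint (R : realType) (u : Cplx R -> R) (z0 : Cplx R) :
  ascent_cone u z0 `&` descent_cone u z0 = set0.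
Proof.
rewrite -subset0 => theta [[_ up] [_ down]].
have [t [ut tu]] := filter_ex (filterI up down).
by have := lt_trans ut tu; rewrite ltxx.
Qed.

(** Where the cosine does not vanish, the error term of the expansion is at most
half of the main term for small [t]. *)
Lemma ray_sign (R : realType) (Omega : set (Cplx R)) (f : Cplx R -> Cplx R)
    (u : Cplx R -> R) (z0 : Cplx R) (s beta theta : R) (k : nat) :
  open Omega -> Omega z0 -> (forall z, Omega z -> u z = complex.Re (f z)) ->
  0 < s -> expansion f z0 (f z0) (s%:C * cis beta) k -> circle theta ->
  (0 < cos (k%:R * theta + beta) -> ascent_cone u z0 theta) /\
  (cos (k%:R * theta + beta) < 0 -> descent_cone u z0 theta).
Proof.
move=> Oo Oz0 uf s0 fE th; set c := cos _.
have Oray : \forall t \near 0^'+, Omega (z0 + t%:C * cis theta).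
  have : \forall z \near (0 : Cplx R), Omega (z0 + z).
    have /nbhs_ballP[e e0 eO] : nbhs z0 Omega by exact: open_nbhs_nbhs.
    apply/nbhs_ballP; exists e => // z ze; apply: eO; move: ze.
    by rewrite /ball /= sub0r opprD addNKr.
  by move=> /(near_real_line (cis theta)) h; apply: cvg_within; exact: h.
have {}Oray : \forall t \near 0^'+,
    u (z0 + t%:C * cis theta) = complex.Re (f (z0 + t%:C * cis theta)).
  by apply: filterS Oray => t /uf.
have pos : \forall t \near 0^'+, 0 < t ^+ k :> R.
  by apply: filterS (nbhs_right_gt 0) => t t0; rewrite exprn_gt0.
split=> c0; split=> //.
  have e0 : 0 < s * c / 2 by rewrite divr_gt0 // mulr_gt0.
  apply: filterS3 (Re_expansion_ray theta fE e0) Oray pos => t + -> tk.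
  rewrite -/c (uf _ Oz0) => /ler_normlP[h _]; rewrite -subr_gt0.
  have : 0 < s * c / 2 * t ^+ k by rewrite mulr_gt0.
  by move: h; move: (complex.Re _) (complex.Re _) => p q; clear; lra.
have e0 : 0 < - (s * c / 2) by rewrite -mulNr -mulrN divr_gt0 // mulr_gt0 // oppr_gt0.
apply: filterS3 (Re_expansion_ray theta fE e0) Oray pos => t + -> tk.
rewrite -/c (uf _ Oz0) => /ler_normlP[_ h]; rewrite -subr_lt0.
have : 0 < - (s * c / 2) * t ^+ k by rewrite mulr_gt0.
by move: h; move: (complex.Re _) (complex.Re _) => p q; clear; lra.
Qed.

Theorem mainTheorem2 (R : realType) (Omega : set (Cplx R)) (z0 : Cplx R)
    (f : Cplx R -> Cplx R) (u : Cplx R -> R) (k : nat)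
    (Omega_open : open Omega) (Omega_connected : connected Omega)
    (z0_Omega : Omega z0)
    (f_holomorphic : holomorphic Omega f)
    (u_Re_f : forall z, Omega z -> u z = complex.Re (f z))
    (k_ge1 : (1 <= k)%N)
    (k_nonzero : derive1n k f z0 <> 0)
    (k_min : forall l : nat, (1 <= l)%N -> derive1n l f z0 <> 0 -> (k <= l)%N) :
  (exists a : R,
     alternating_sectors (ascent_cone u z0) (descent_cone u z0) k a) /\
  (forall s beta : R, 0 < s -> derive1n k f z0 = s%:C * cis beta ->
     [/\ alternating_sectors (ascent_cone u z0) (descent_cone u z0) k
           ((- (2 * beta) - pi) / (2 * k%:R)),
         forall theta : R, circle theta ->
           (exists phi : R,
              (- (2 * beta) - pi) / (2 * k%:R) < phi
                < (- (2 * beta) + pi) / (2 * k%:R) /\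
              congr_mod (2 * pi / k%:R) theta phi) ->
           ascent_cone u z0 theta
       & forall theta : R, circle theta ->
           (exists phi : R,
              (- (2 * beta) + pi) / (2 * k%:R) < phi
                < (- (2 * beta) + 3 * pi) / (2 * k%:R) /\
              congr_mod (2 * pi / k%:R) theta phi) ->
           descent_cone u z0 theta]).
Proof.
have fd : derivable f z0 1 by exact: f_holomorphic.
set c := derive1n k f z0 in k_nonzero *.
have fE : expansion f z0 (f z0) (c / k`!%:R) k.
  case: k k_ge1 @c k_nonzero k_min => // n _ c c0 cmin.
  apply: first_derivative_expansion => //; first exact/eqP.
  move=> l /andP[l1 ln]; apply: contrapT => /(cmin _ l1).
  by rewrite leqNgt ltnS ln.
have kR : 0 < k%:R :> R by rewrite ltr0n.
have sectors (s beta : R) : 0 < s -> c = s%:C * cis beta ->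
    alternating_sectors (ascent_cone u z0) (descent_cone u z0) k
      ((- (2 * beta) - pi) / (2 * k%:R)) /\
    forall theta : R, circle theta ->
      (0 < cos (k%:R * theta + beta) -> ascent_cone u z0 theta) /\
      (cos (k%:R * theta + beta) < 0 -> descent_cone u z0 theta).
  move=> s0 cE; pose s' := s / k`!%:R.
  have s'0 : 0 < s' by rewrite divr_gt0 // ltr0n fact_gt0.
  have {}fE : expansion f z0 (f z0) (s'%:C * cis beta) k.
    have -> // : s'%:C * cis beta = c / k`!%:R.
    by rewrite cE /s' rmorphM fmorphV rmorph_nat; ring.
  have sgn theta := @ray_sign R Omega f u z0 s' beta theta k Omega_open z0_Omega
    u_Re_f s'0 fE.
  split=> //; apply: alternating_sectors_cos => //.
  - exact: ascent_descent_disjoint.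
  - by move=> theta /sgn[].
  - by move=> theta /sgn[].
split.
  have [s [beta [s0 cE]]] := polar_form (introN eqP k_nonzero).
  by exists ((- (2 * beta) - pi) / (2 * k%:R)); have [] := sectors s beta s0 cE.
move=> s beta s0 cE; have [alt sgn] := sectors s beta s0 cE.
(* A change of theta by 2 * pi / k changes the phase by 2 * pi, so the two
   remaining claims are about the phases around 0 and around pi. *)
have period : k%:R * (2 * pi / k%:R) = 2 * pi :> R by field; exact: lt0r_neq0.
have scale (d phi : R) : (k%:R * (d / (2 * k%:R)) = d / 2).
  by field; exact: lt0r_neq0.
split=> // theta th [phi [/andP[phi1 phi2] [m thE]]]; have [up down] := sgn theta th;
  [apply: up|apply: down]; rewrite (phase_congr beta period thE);
  move: phi1 phi2; rewrite -(ltr_pM2l kR) scale // => phi1;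
  rewrite -(ltr_pM2l kR) scale // => phi2.
  rewrite -[cos _]mul1r -[1]/((-1) ^+ 0); apply: cos_sign.
  by apply/andP; split; lra.
rewrite -oppr_gt0 -mulN1r -[-1]/((-1) ^+ 1); apply: cos_sign.
by apply/andP; split; lra.
Qed.
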